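(* Let $\mathcal{E}$ and $\mathcal{R}$ be finite sets (entities and relations) and let $m\ge 1$. DistMult embeddings can be fully recovered by ANALOGY embeddings with $n=m$. That is, for every choice of DistMult embeddings $v_e\in\mathbb{R}^m$ ($e\in\mathcal{E}$) and $v_r\in\mathbb{R}^m$ ($r\in\mathcal{R}$), there exist vectors $u_e\in\mathbb{R}^m$ ($e\in\mathcal{E}$) and matrices $B_r\in\mathcal{B}^m_m$ ($r\in\mathcal{R}$) such that for all $s,o\in\mathcal{E}$ and $r\in\mathcal{R}$, $$\langle v_s,v_r,v_o\rangle = u_s^\top B_r u_o .$$
   Context: The DistMult model assigns real vectors in $\mathbb{R}^m$ to entities and relations, with score $\phi(s,r,o)=\langle v_s,v_r,v_o\rangle$, where $\langle a,b,c\rangle=\sum_{k=1}^m a_kb_kc_k$ is the generalized (trilinear) inner product. The ANALOGY model of embedding size $m$ with parameter $n$ assigns a vector $u_e\in\mathbb{R}^m$ to each entity $e$ and a matrix $B_r\in\mathcal{B}^n_m$ to each relation $r$, with score $\phi(s,r,o)=u_s^\top B_r u_o$. Here $\mathcal{B}^n_m$ ($0\le n\le m$, $m-n$ even) is the set of $m\times m$ real block-diagonal matrices with $n$ real scalar ($1\times1$) diagonal blocks and $(m-n)/2$ diagonal blocks of the form $\begin{bmatrix} x & -y\\ y & x\end{bmatrix}$, $x,y\in\mathbb{R}$, with block positions the same for all matrices in the set. In particular $\mathcal{B}^m_m$ is the set of real diagonal $m\times m$ matrices. *)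

(* Defs.v *)
From HB Require Import structures.
From mathcomp Require Import all_boot all_order all_algebra.
From mathcomp Require Import reals.

Set Implicit Arguments.
Unset Strict Implicit.
Unset Printing Implicit Defensive.

Import Order.TTheory GRing.Theory Num.Theory.
Local Open Scope ring_scope.

Definition trilinear (R : realType) (m : nat) (a b c : 'cV[R]_m) : R :=
  \sum_(k < m) a k 0 * b k 0 * c k 0.

Definition distmult_score (R : realType) (m : nat) (Ent Rel : finType)
    (v : Ent -> 'cV[R]_m) (w : Rel -> 'cV[R]_m) (s : Ent) (r : Rel) (o : Ent) : R :=
  trilinear (v s) (w r) (v o).

(* The product is a 1 x 1 matrix, hence the final [0 0]. *)
Definition analogy_score (R : realType) (m : nat) (Ent Rel : finType)
    (u : Ent -> 'cV[R]_m) (B : Rel -> 'M[R]_m) (s : Ent) (r : Rel) (o : Ent) : R :=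
  ((u s)^T *m B r *m u o) 0 0.

Definition rotation_block (R : realType) (x y : R) : 'M[R]_2 :=
  block_mx (x%:M : 'M_1) (- y)%:M
           y%:M          x%:M.

Inductive analogy_block (R : realType) : forall d : nat, 'M[R]_d -> Prop :=
| ScalarBlock (x : R) : analogy_block (x%:M : 'M[R]_1)
| RotationBlock (x y : R) : analogy_block (rotation_block x y).

(* The common block positions of all matrices in B^n_m are recorded as the
   list [L] of successive block sizes along the diagonal. *)
Definition block_layout (n m : nat) (L : seq nat) : Prop :=
  [/\ all (fun d => (d == 1) || (d == 2))%N L,
      count_mem 1%N L = n,
      count_mem 2%N L = ((m - n)./2)%N
    & sumn L = m].

(* The set B^n_m for the block positions [L]. *)
Definition analogy_mx (R : realType) (n m : nat) (L : seq nat) (A : 'M[R]_m) : Prop :=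
  block_layout n m L /\
  exists (e : (\sum_(i < size L) nth 0 L i)%N = m)
         (D : forall i : 'I_(size L), 'M[R]_(nth 0%N L i)),
    (forall i, analogy_block (D i)) /\ A = castmx (e, e) (\mxdiag_i D i).

Arguments analogy_mx {R} n m L A.

Lemma block_layout_exists (n m : nat) :
  (n <= m)%N -> ~~ odd (m - n) -> exists L, block_layout n m L.
Proof.
move=> le_nm ev; exists (nseq n 1%N ++ nseq (m - n)./2 2%N); split.
- by rewrite all_cat !all_nseq /= !orbT.
- by rewrite count_cat !count_nseq /= mul1n mul0n addn0.
- by rewrite count_cat !count_nseq /= mul1n mul0n.
- by rewrite sumn_cat !sumn_nseq mul1n mul2n even_halfK // subnKC.
Qed.

(* Main.v *)
Require Import Defs.
From HB Require Import structures.
From mathcomp Require Import all_boot all_order all_algebra.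
From mathcomp Require Import reals.

Import Order.TTheory GRing.Theory Num.Theory.
Local Open Scope ring_scope.

(** Keep the entity vectors and turn each relation vector into the diagonal matrix carrying it: the
    bilinear form of a diagonal matrix is the trilinear product. Membership of diagonal matrices in
    the ANALOGY set for n = m is [analogy_mx_diag]: every block then has size 1, and a diagonal
    matrix is the block sum of its diagonal blocks. *)

(** The layout has (m - m)/2 = 0 blocks of size 2. *)
Lemma block_layout_full_size (m : nat) (L : seq nat) (d : nat) :
  block_layout m m L -> d \in L -> d = 1%N.
Proof.
case=> /allP L12 _; rewrite subnn => /eqP L2 _ dL.
case/orP: (L12 d dL) => /eqP // d2; move: L2.
by rewrite -leqn0 leqNgt -has_count has_pred1 -d2 dL.
Qed.

(** The size is a variable [d] because the sizes [nth 0 L i] equal 1 only propositionally. *)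
Lemma analogy_block_size1 (R : realType) (d : nat) (A : 'M[R]_d) :
  d = 1%N -> analogy_block A.
Proof.
by move=> d1; subst d; rewrite [A]mx11_scalar; apply: ScalarBlock.
Qed.

Lemma diag_mxdiag (V : nmodType) (k : nat) (p : 'I_k -> nat)
    (A : 'M[V]_(\sum_i p i)) :
  is_diag_mx A -> A = \mxdiag_i submxblock A i i.
Proof.
rewrite -{1}[A]submxblockK => /is_diag_mxblockP[A0 _].
rewrite -{1}[A]submxblockK; apply: eq_mxblock => i j.
by case: eqVneq => [<- | /A0 //]; rewrite conform_mx_id.
Qed.

Lemma analogy_mx_diag (R : realType) (m : nat) (L : seq nat) (A : 'M[R]_m) :
  block_layout m m L -> is_diag_mx A -> analogy_mx m m L A.
Proof.
move=> hL diagA; split=> //.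
have e : (\sum_(i < size L) nth 0 L i)%N = m.
  by case: hL => _ _ _ <-; rewrite sumnE (big_nth 0%N) big_mkord.
have L1 (i : 'I_(size L)) : nth 0%N L i = 1%N.
  by apply: block_layout_full_size hL _; apply: mem_nth.
(* Replacing [m] by the sum of the block sizes makes the cast trivial. *)
clear hL; subst m; exists erefl, (fun i => submxblock A i i); split=> [i|].
  exact: analogy_block_size1.
by rewrite castmx_id; apply: diag_mxdiag.
Qed.

Theorem proposition5p1 (R : realType) (Ent Rel : finType) (m : nat) (hm : (1 <= m)%N)
    (L : seq nat) (hL : block_layout m m L)
    (v : Ent -> 'cV[R]_m) (w : Rel -> 'cV[R]_m) :
  exists (u : Ent -> 'cV[R]_m) (B : Rel -> 'M[R]_m),
    (forall r : Rel, analogy_mx m m L (B r)) /\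
    (forall (s : Ent) (r : Rel) (o : Ent),
       distmult_score v w s r o = analogy_score u B s r o).
Proof.
exists v, (fun r => diag_mx (w r)^T); split=> [r | s r o].
  exact/analogy_mx_diag/diag_mx_is_diag.
rewrite /distmult_score /analogy_score /trilinear mul_mx_diag mxE.
by apply: eq_bigr => k _; rewrite !mxE.
Qed.
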